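(* Let $P(z)\in\mathbb{C}[z]$ be a homogeneous Hessian nilpotent polynomial of degree $d\ge 3$ and let $\mathcal{I}(P)$ be the ideal of $\mathbb{C}[z]$ generated by $\sigma^2:=\sum_{i=1}^nz_i^2$ and $\frac{\partial P}{\partial z_i}$ $(1\le i\le n)$. Then for any $f(z)\in\mathcal{I}(P)$ and $m\ge 0$, $$f(D)\,\Delta^mP^{m+1}=0 .$$
   Context: $z=(z_1,\dots,z_n)$, $\Delta=\sum_{i=1}^n \partial^2/\partial z_i^2$, $D=(D_1,\dots,D_n)$ with $D_i=\partial/\partial z_i$, and $f(D)$ is the constant-coefficient differential operator obtained by substituting $D_i$ for $z_i$ in $f$. $P$ is Hessian nilpotent if its Hessian matrix $\left(\frac{\partial^2 P}{\partial z_i\partial z_j}\right)$ is nilpotent. *)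

(* Defs.v *)
From mathcomp Require Import all_boot all_order all_algebra.
From mathcomp Require Import mpoly.

Set Implicit Arguments.
Unset Strict Implicit.
Unset Printing Implicit Defensive.

Import GRing.Theory.

Local Open Scope ring_scope.

Definition ideal_generated (A : comNzRingType) (gs : seq A) (f : A) : Prop :=
  exists c : 'I_(size gs) -> A, f = \sum_(k < size gs) c k * gs`_k.

Definition hessian (n : nat) (C : comNzRingType) (P : {mpoly C[n]}) :
    'M[{mpoly C[n]}]_n :=
  \matrix_(i < n, j < n) mderiv j (mderiv i P).

Definition hessian_nilpotent (n : nat) (C : comNzRingType)
    (P : {mpoly C[n]}) : Prop :=
  exists k : nat, hessian P ^+ k = 0.

Definition laplacian (n : nat) (C : comNzRingType) (g : {mpoly C[n]}) :
    {mpoly C[n]} :=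
  \sum_(i < n) mderiv i (mderiv i g).

(* [poly_diffop f g] is f(D) g: each monomial of f acts on g as the
   corresponding iterated (not divided) partial derivative. *)
Definition poly_diffop (n : nat) (C : comNzRingType) (f g : {mpoly C[n]}) :
    {mpoly C[n]} :=
  \sum_(a <- msupp f) f@_a *: mderivm a g.

Definition sigma2 (n : nat) (C : comNzRingType) : {mpoly C[n]} :=
  \sum_(i < n) 'X_i ^+ 2.

Definition ideal_I (n : nat) (C : comNzRingType) (P : {mpoly C[n]}) :
    {mpoly C[n]} -> Prop :=
  ideal_generated (sigma2 n C :: [seq mderiv i P | i <- enum 'I_n]).

(* Main.v *)
(** Expanding the Laplacian of a product g h into the Laplacians of the two
    factors and twice the scalar product of their gradients, one sees that if g
    is harmonic and homogeneous of degree e and Delta^(m+1) h = 0, then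
    Delta^(m+e) (g h) is a nonzero multiple of g(D) Delta^m h.  Take
    g = dP/dz_i, h = P^(m+1) and e = d - 1: the product g h is, up to a scalar,
    the z_i-derivative of P^(m+2), which Delta^(m+2) annihilates, and
    m + d - 1 >= m + 2.

    What remains is that Delta^m P^m = 0 for m >= 1.  Let Q be the power series
    in t with Q(0) = P and 2 dQ/dt = |grad Q|^2.  Along the derivation
    delta = d/dt - grad Q . grad its Hessian H satisfies delta H = H^2, so that
    delta tr H^k = k tr H^(k+1); all these traces vanish at t = 0, hence
    identically, and Q is harmonic.  Then
    Delta Q^(m+1) = 2 (m+1) dQ^m/dt, and induction gives Delta^m Q^m = 0.
    Here Q is a polynomial in t solving the equation modulo t^N. *)

From HB Require Import structures.
Require Import Defs.
From mathcomp Require Import all_boot all_order all_algebra.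
From mathcomp Require Import ssrcomplements mpoly complex reals.
From mathcomp Require Import ring.

Set Implicit Arguments.
Unset Strict Implicit.
Unset Printing Implicit Defensive.

Import GRing.Theory Num.Theory.

Local Open Scope ring_scope.

(** * Constant-coefficient operators and iterated Laplacians of products *)

Section Operators.
Context (n : nat) (C : comNzRingType).
Implicit Types (f g h : {mpoly C[n]}) (a : 'X_{1..n}).

Lemma laplacian_is_linear : linear (@laplacian n C).
Proof.
move=> c g h; rewrite /laplacian scaler_sumr -big_split /=.
by apply: eq_bigr => i _; rewrite !linearP.
Qed.

HB.instance Definition _ :=
  GRing.isLinear.Build C {mpoly C[n]} {mpoly C[n]} _ (@laplacian n C)
    laplacian_is_linear.

Lemma iter_laplacian_is_linear m : linear (iter m (@laplacian n C)).
Proof. by move=> c g h; elim: m => //= m ->; rewrite linearP. Qed.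

HB.instance Definition _ m :=
  GRing.isLinear.Build C {mpoly C[n]} {mpoly C[n]} _
    (iter m (@laplacian n C)) (iter_laplacian_is_linear m).

Lemma mderiv_iter_laplacian i m g :
  iter m (@laplacian n C) (mderiv i g) = mderiv i (iter m (@laplacian n C) g).
Proof.
elim: m => //= m ->; rewrite /laplacian linear_sum /=.
by apply: eq_bigr => j _; rewrite (mderiv_comm j i) (mderiv_comm j i).
Qed.

Lemma laplacianM g h :
  laplacian (g * h) = laplacian g * h + g * laplacian h
    + (\sum_i mderiv i g * mderiv i h) *+ 2.
Proof.
rewrite /laplacian mulr_suml mulr_sumr -sumrMnl -!big_split /=.
apply: eq_bigr => i _; rewrite !(mderivM, mderivD) mulr2n.
by rewrite -!addrA; congr (_ + _); rewrite [RHS]addrC !addrA.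
Qed.

Lemma iter_laplacian0 j k g :
  iter j (@laplacian n C) g = 0 -> (j <= k)%N ->
  iter k (@laplacian n C) g = 0.
Proof. by move=> g0 /subnK <-; rewrite iterD g0 linear0. Qed.

(** An index set independent of the support of [f] turns additivity in [f] into a termwise check. *)
Lemma poly_diffop_bounded k f g : (msize f <= k)%N ->
  poly_diffop f g = \sum_(a : 'X_{1..n < k}) f@_a *: mderivm a g.
Proof.
move=> fk; rewrite /poly_diffop (big_mksub 'X_{1..n < k}) /=; first last.
- by move=> a /msize_mdeg_lt /leq_trans; apply.
- exact: msupp_uniq.
by rewrite big_rmcond //= => a /memN_msupp_eq0 ->; rewrite scale0r.
Qed.

Lemma poly_diffop_is_linear f : linear (poly_diffop f).
Proof.
move=> c g h; rewrite /poly_diffop scaler_sumr -big_split /=.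
by apply: eq_bigr => a _; rewrite linearP scalerDr !scalerA mulrC.
Qed.

HB.instance Definition _ f :=
  GRing.isLinear.Build C {mpoly C[n]} {mpoly C[n]} _ (poly_diffop f)
    (poly_diffop_is_linear f).

Lemma poly_diffopPl c f g h :
  poly_diffop (c *: f + g) h = c *: poly_diffop f h + poly_diffop g h.
Proof.
pose k := maxn (msize (c *: f + g)) (maxn (msize f) (msize g)).
rewrite !(@poly_diffop_bounded k) ?leq_max ?leqnn ?orbT //.
rewrite scaler_sumr -big_split /=; apply: eq_bigr => a _.
by rewrite mcoeffD mcoeffZ scalerDl scalerA.
Qed.

Lemma poly_diffop_suml (I : Type) (r : seq I) (A : pred I) (F : I -> {mpoly C[n]}) h :
  poly_diffop (\sum_(i <- r | A i) F i) h
  = \sum_(i <- r | A i) poly_diffop (F i) h.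
Proof.
elim/big_rec2: _ => [|i u v _ <-].
  by rewrite /poly_diffop msupp0 big_nil.
by rewrite -[F i]scale1r poly_diffopPl !scale1r.
Qed.

Lemma poly_diffopZl c f h : poly_diffop (c *: f) h = c *: poly_diffop f h.
Proof.
rewrite -[c *: f]addr0 poly_diffopPl [X in _ + X](_ : _ = 0) ?addr0 //.
by rewrite /poly_diffop msupp0 big_nil.
Qed.

Lemma poly_diffopX a h : poly_diffop 'X_[a] h = mderivm a h.
Proof. by rewrite /poly_diffop msuppX big_seq1 mcoeffX eqxx scale1r. Qed.

(** This reduces an ideal to its generators: [(c g)(D) h] vanishes as soon as [g(D) h] does. *)
Lemma poly_diffopM f g h : poly_diffop (f * g) h = poly_diffop f (poly_diffop g h).
Proof.
rewrite [f in LHS]mpolyE mulr_suml poly_diffop_suml.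
apply: eq_bigr => a _; rewrite -scalerAl poly_diffopZl; congr (_ *: _).
rewrite [g in LHS]mpolyE mulr_sumr poly_diffop_suml [in RHS]/poly_diffop linear_sum.
apply: eq_bigr => b _; rewrite -scalerAr poly_diffopZl linearZ; congr (_ *: _).
by rewrite -mpolyXD poly_diffopX addmC mderivmDm.
Qed.

Lemma poly_diffop_sigma2 h : poly_diffop (sigma2 n C) h = laplacian h.
Proof.
rewrite /sigma2 /laplacian poly_diffop_suml; apply: eq_bigr => i _.
by rewrite expr2 poly_diffopM !poly_diffopX !mderivmU1m.
Qed.

(** Composing [(dg/dz_i)(D)] with [D_i] gives the operator of [z_i dg/dz_i], and by Euler's identity
    these symbols add up to [e g]. *)
Lemma poly_diffop_euler e g h : g \is e.-homog ->
  \sum_i poly_diffop (mderiv i g) (mderiv i h) = poly_diffop g h *+ e.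
Proof.
move=> /dhomogP g_homog; rewrite [in RHS]/poly_diffop -sumrMnl.
transitivity (\sum_(a <- msupp g) \sum_i
    (a i)%:R *: (g@_a *: mderivm a h)).
  rewrite exchange_big; apply: eq_bigr => i _.
  rewrite poly_diffop_suml; apply: eq_bigr => a _.
  rewrite poly_diffopZl poly_diffopX -scalerA -mderivmU1m -mderivmDm.
  (* Subtracting [U_(i)] and adding it back recovers [a] only if [a i] is positive; otherwise the
     factor [a i] kills the term. *)
  have [->|ai] := eqVneq (a i) 0%N; first by rewrite !scale0r.
  by rewrite addmC submK // lep1mP.
rewrite [LHS]big_seq [RHS]big_seq; apply: eq_bigr => a /g_homog /= <-.
by rewrite -scaler_suml mdegE -natr_sum scaler_nat.
Qed.

Lemma dhomog_mderiv e i g : g \is e.+1.-homog -> mderiv i g \is e.-homog.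
Proof.
move=> gh; apply/dhomogP => a; rewrite mcoeff_msupp mcoeff_mderiv => gai.
have: (a + U_(i))%MM \in msupp g.
  by rewrite mcoeff_msupp; apply: contraNneq gai => ->; rewrite mul0rn.
by move/(dhomog_mf gh); rewrite /= mdegD mdeg1 addn1 => -[].
Qed.

Lemma mderivXn i g k : mderiv i (g ^+ k.+1) = mderiv i g * g ^+ k *+ k.+1.
Proof.
elim: k => [|k IH]; first by rewrite mulr1.
by rewrite exprS mderivM IH mulrnAr mulrCA -exprS -mulrS.
Qed.

(* Total contraction: since [g] absorbs exactly [e] derivatives and [h] dies
   after [m] Laplacians, only the term where the [e] mixed Laplacians
   [2 grad_g . grad_h] use up all of [g] survives. *)
Lemma iter_laplacian_harmonicM (e m : nat) : exists2 c, (0 < c)%N &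
  forall g h, g \is e.-homog -> laplacian g = 0 ->
    iter m.+1 (@laplacian n C) h = 0 ->
    iter (m + e) (@laplacian n C) (g * h)
      = poly_diffop g (iter m (@laplacian n C) h) *+ c.
Proof.
elim: e m => [|e IHe] m.
  exists 1%N => // g h /dhomogP g_homog _ _.
  have -> : g = (g@_0) *: 'X_[0].
    apply/mpolyP => a; rewrite mcoeffZ mcoeffX.
    have [<-|/negbTE a0] := eqVneq; first by rewrite mulr1.
    rewrite mulr0; apply/memN_msupp_eq0/negP => /g_homog /eqP /=.
    by rewrite mdeg_eq0 eq_sym a0.
  by rewrite poly_diffopZl poly_diffopX mderivm0m addn0 mpolyX0 -scalerAl
    mul1r linearZ.
(* The hypothesis on [e] applies to each pair [mderiv i g], [mderiv i h]; Euler's identity sums the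
   results, whence the factor [e.+1]. *)
have deriv_step k : exists2 c, (0 < c)%N & forall g h,
    g \is e.+1.-homog -> laplacian g = 0 ->
    iter k.+1 (@laplacian n C) h = 0 ->
    iter (k + e) (@laplacian n C) (\sum_i mderiv i g * mderiv i h)
      = poly_diffop g (iter k (@laplacian n C) h) *+ c.
  have [c c_gt0 IH] := IHe k; exists (e.+1 * c)%N => [|g h gh g0 h0].
    by rewrite muln_gt0.
  rewrite linear_sum mulrnA -(poly_diffop_euler _ gh) -sumrMnl /=.
  apply: eq_bigr => i _; rewrite IH -?mderiv_iter_laplacian //.
  - exact: dhomog_mderiv.
  - by have := mderiv_iter_laplacian i 1 g; rewrite /= g0 linear0.
  - by rewrite mderiv_iter_laplacian h0 linear0.
elim: m => [|m [c' c'_gt0 IHm]].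
  have [c c_gt0 step] := deriv_step 0%N.
  exists (c * 2)%N => [|g h gh g0 h0]; first by rewrite muln_gt0 c_gt0.
  rewrite add0n iterSr laplacianM g0 mul0r add0r.
  have /= -> := h0; rewrite mulr0 add0r linearMn /= mulrnA.
  by rewrite -(step g h gh g0 h0).
(* The term [g * laplacian h] falls to the induction on [m], the gradient term to [deriv_step]; both
   constants are positive, so they cannot cancel. *)
have [c c_gt0 step] := deriv_step m.+1.
exists (c' + c * 2)%N => [|g h gh g0 h0]; first by rewrite addn_gt0 c'_gt0.
rewrite addnS iterSr laplacianM g0 mul0r add0r linearD linearMn.
rewrite [X in _ + X *+ 2](step g h) // mulrnDr mulrnA; congr (_ + _).
by rewrite addSnnS [LHS]IHm -?iterSr.
Qed.

End Operators.
(** Since [X - M] divides [X^k - M^k = X^k], the characteristic polynomial divides a power of [X].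
    Being monic of degree [n], it is [X^n], and the trace is minus its coefficient of degree
    [n - 1]. *)
Lemma mxtrace_nilpotent (R : idomainType) (n k : nat) (M : 'M[R]_n) :
  M ^+ k = 0 -> \tr M = 0.
Proof.
case: n M => [|n] M Mk0; first by rewrite /mxtrace big_ord0.
pose X : 'M[{poly R}]_n.+1 := 'X%:M; pose Mp := map_mx polyC M.
have XMC : GRing.comm X Mp by apply/esym/scalar_mxC.
have dvd_char : char_poly M %| ('X - 0%:P) ^+ (k * n.+1).
  have <- : \det (X ^+ k - Mp ^+ k) = ('X - 0%:P) ^+ (k * n.+1).
    have -> : Mp ^+ k = 0 by rewrite -[LHS]rmorphXn Mk0 raddf0.
    by rewrite !subr0 -[X ^+ k]rmorphXn det_scalar exprM.
  by rewrite subrXX_comm // det_mulmx dvdp_mulr.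
have [j _] := dvdp_exp_XsubCP dvd_char.
rewrite subr0 eqp_monic ?char_poly_monic ?monicXn // => /eqP char_XE.
have := size_char_poly M; rewrite char_XE size_polyXn => -[jn].
apply/eqP; rewrite -oppr_eq0 -char_poly_trace // char_XE coefXn jn.
by rewrite eqn_leq ltnn andbF.
Qed.

(** * Order of vanishing in t *)

Section Order.
Context (A : comNzRingType).
Implicit Types (p q : {poly A}) (N : nat).

(** Divisibility by [t^N]: congruences modulo [t^N] stand in for identities of power series. *)
Definition vanish N p := forall i, (i < N)%N -> p`_i = 0.

Lemma vanish0 N : vanish N 0.
Proof. by move=> i _; rewrite coef0. Qed.

Lemma vanishW N M p : (M <= N)%N -> vanish N p -> vanish M p.
Proof. by move=> MN pN i iM; apply/pN/(leq_trans iM). Qed.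

Lemma vanishD N p q : vanish N p -> vanish N q -> vanish N (p + q).
Proof. by move=> pN qN i iN; rewrite coefD pN // qN // addr0. Qed.

Lemma vanishN N p : vanish N p -> vanish N (- p).
Proof. by move=> pN i iN; rewrite coefN pN // oppr0. Qed.

Lemma vanishMn N p k : vanish N p -> vanish N (p *+ k).
Proof. by move=> pN i iN; rewrite coefMn pN // mul0rn. Qed.

Lemma vanish_sum N (I : finType) (F : I -> {poly A}) :
  (forall i, vanish N (F i)) -> vanish N (\sum_i F i).
Proof.
by move=> FN i iN; rewrite coef_sum big1 // => j _; apply: FN.
Qed.

Lemma vanishMr N p q : vanish N p -> vanish N (p * q).
Proof.
move=> pN i iN; rewrite coefM big1 // => j _.
by rewrite pN ?mul0r // (leq_ltn_trans _ iN) // -ltnS.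
Qed.

Lemma vanishMl N p q : vanish N q -> vanish N (p * q).
Proof. by rewrite mulrC; apply: vanishMr. Qed.

Lemma vanish_deriv N p : vanish N.+1 p -> vanish N p^`().
Proof. by move=> pN i iN; rewrite coef_deriv pN ?mul0rn. Qed.

Lemma vanish_map (f : {additive A -> A}) N p :
  vanish N p -> vanish N (map_poly f p).
Proof. by move=> pN i iN; rewrite coef_map pN // raddf0. Qed.

Lemma map_poly_deriv (f : {additive A -> A}) p :
  map_poly f p^`() = (map_poly f p)^`().
Proof. by apply/polyP => i; rewrite coef_map !coef_deriv coef_map raddfMn. Qed.

Lemma map_polyM_derivation (f : {additive A -> A}) p q :
  (forall x y, f (x * y) = f x * y + x * f y) ->
  map_poly f (p * q) = map_poly f p * q + p * map_poly f q.
Proof.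
move=> fM; apply/polyP => i; rewrite coefD coef_map !coefM raddf_sum -big_split.
by apply: eq_bigr => j _ /=; rewrite fM !coef_map.
Qed.

End Order.

(** * Truncated solutions of Burgers' equation *)

Section Burgers.
Context (n : nat) (C : numFieldType).
Local Notation A := {mpoly C[n]}.
Implicit Types (p q Q : {poly A}) (N k : nat).

(** The indeterminate of [{poly A}] is the time t; derivatives in z act on its coefficients. *)
Definition pderiv (i : 'I_n) p := map_poly (mderiv i) p.
Definition plap p := map_poly (@laplacian n C) p.

Lemma pderivD i p q : pderiv i (p + q) = pderiv i p + pderiv i q.
Proof. exact: raddfD. Qed.

Lemma pderivN i p : pderiv i (- p) = - pderiv i p.
Proof. exact: raddfN. Qed.

Lemma pderivMn i p k : pderiv i (p *+ k) = pderiv i p *+ k.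
Proof. exact: raddfMn. Qed.

Lemma pderiv_sum i (I : finType) (F : I -> {poly A}) :
  pderiv i (\sum_j F j) = \sum_j pderiv i (F j).
Proof. exact: raddf_sum. Qed.

Lemma pderivM i p q : pderiv i (p * q) = pderiv i p * q + p * pderiv i q.
Proof. by apply: map_polyM_derivation => x y; apply: mderivM. Qed.

Lemma pderivX i p k : pderiv i (p ^+ k.+1) = p ^+ k * pderiv i p *+ k.+1.
Proof.
elim: k => [|k IH]; first by rewrite expr0 mul1r.
by rewrite exprS pderivM IH mulrnAr mulrA -exprS mulrC -mulrS.
Qed.

Lemma pderiv_comm i j p : pderiv i (pderiv j p) = pderiv j (pderiv i p).
Proof. by apply/polyP => l; rewrite !coef_map /= mderiv_comm. Qed.

Lemma pderiv_deriv i p : pderiv i p^`() = (pderiv i p)^`().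
Proof. exact: map_poly_deriv. Qed.

Lemma vanish_pderiv N i p : vanish N p -> vanish N (pderiv i p).
Proof. exact: vanish_map. Qed.

Lemma plapE p : plap p = \sum_i pderiv i (pderiv i p).
Proof.
by apply/polyP => l; rewrite coef_map coef_sum; apply: eq_bigr => i _;
  rewrite !coef_map.
Qed.

Lemma coef_iter_plap m p i :
  (iter m plap p)`_i = iter m (@laplacian n C) p`_i.
Proof. by elim: m => //= m IH; rewrite coef_map IH. Qed.

(** The defect of [2 dQ/dt = |grad Q|^2], whose gradient is Burgers' equation for [grad Q]. *)
Definition burgers Q := Q^`() *+ 2 - \sum_i pderiv i Q ^+ 2.

Lemma coef_burgers Q i : (burgers Q)`_i = Q`_i.+1 *+ i.+1 *+ 2
  - \sum_(c < n) \sum_(j < i.+1) mderiv c Q`_j * mderiv c Q`_(i - j).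
Proof.
rewrite /burgers coefB coefMn coef_deriv coef_sum; congr (_ - _).
apply: eq_bigr => c _; rewrite expr2 coefM.
by apply: eq_bigr => j _; rewrite !coef_map.
Qed.

(** Coefficient [N] of the defect contains coefficient [N.+1] of [Q] only linearly, with factor
    [2 * N.+1]; the quadratic part stops at index [N]. Correcting that one coefficient cancels the
    error and leaves lower orders untouched. *)
Lemma burgers_solution N (P : A) :
  exists Q, Q`_0 = P /\ vanish N (burgers Q).
Proof.
elim: N => [|N [Q [Q0 QN]]].
  by exists P%:P; rewrite coefC.
pose r := (2 * N.+1)%:R^-1 *: (burgers Q)`_N.
have rE : r *+ N.+1 *+ 2 = (burgers Q)`_N.
  rewrite -mulrnA -scaler_nat scalerA mulnC mulfV ?scale1r //.
  by rewrite pnatr_eq0.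
exists (Q - r%:P * 'X^(N.+1)).
have low j : (j <= N)%N -> (Q - r%:P * 'X^(N.+1))`_j = Q`_j.
  by move=> jN; rewrite coefB coefMXn ltnS jN subr0.
split=> [|i]; first by rewrite low.
rewrite ltnS => iN; rewrite coef_burgers.
have -> : \sum_(c < n) \sum_(j < i.+1) mderiv c (Q - r%:P * 'X^(N.+1))`_j *
      mderiv c (Q - r%:P * 'X^(N.+1))`_(i - j)
    = \sum_(c < n) \sum_(j < i.+1) mderiv c Q`_j * mderiv c Q`_(i - j).
  apply: eq_bigr => c _; apply: eq_bigr => j _.
  rewrite !low // ?(leq_trans (leq_subr _ _)) // (leq_trans _ iN) //.
  by rewrite -ltnS.
rewrite coefB coefMXn ltnS; case: ltngtP iN => // [iN|->] _.
  by rewrite subr0 -coef_burgers QN.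
by rewrite subnn coefC eqxx !mulrnBl rE addrAC -coef_burgers subrr.
Qed.

(* The derivation delta of the introduction. *)
Definition convective Q p := p^`() - \sum_c pderiv c Q * pderiv c p.

Lemma convectiveM Q p q :
  convective Q (p * q) = convective Q p * q + p * convective Q q.
Proof.
rewrite /convective derivM mulrBl mulrBr mulr_suml mulr_sumr.
under eq_bigr do rewrite pderivM mulrDr mulrA mulrCA.
by rewrite big_split /= opprD; ring.
Qed.

Lemma convective_sum Q (I : finType) (F : I -> {poly A}) :
  convective Q (\sum_i F i) = \sum_i convective Q (F i).
Proof.
rewrite /convective raddf_sum sumrB exchange_big; congr (_ - _).
by apply: eq_bigr => c _; rewrite pderiv_sum mulr_sumr.
Qed.

Definition phessian Q : 'M[{poly A}]_n :=
  \matrix_(i, j) pderiv j (pderiv i Q).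

(* The Riccati equation delta H = H^2, with the defect of Burgers' equation on
   the right. *)
Lemma convective_phessian Q a b :
  (convective Q (phessian Q a b) - (phessian Q *m phessian Q) a b) *+ 2
  = pderiv b (pderiv a (burgers Q)).
Proof.
rewrite /convective /burgers !(pderivD, pderivN, pderivMn, pderiv_sum).
rewrite !pderiv_deriv !mxE -addrA -opprD -big_split /= mulrnBl; congr (_ - _).
rewrite -sumrMnl; apply: eq_bigr => c _.
rewrite !mxE pderivX expr1 pderivMn pderivM.
rewrite (pderiv_comm c b) (pderiv_comm c a) (pderiv_comm b c Q).
by congr (_ *+ _); rewrite addrC [in LHS]mulrC.
Qed.

Lemma vanish_half N p : vanish N (p *+ 2) -> vanish N p.
Proof.
move=> p2 i /p2; rewrite coefMn -scaler_nat => /eqP.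
by rewrite scaler_eq0 pnatr_eq0 => /eqP.
Qed.

(** * Traces of Hessian powers, harmonicity and powers of Q *)

Section HessianFlow.
Context (N : nat) (Q : {poly A}) (QN : vanish N (burgers Q)).
Local Notation H := (phessian Q).

(** Leibniz's rule on [H^k H] and the Riccati equation give [k H^(k+1) H + H^k H^2]. *)
Lemma convective_phessianX k a b :
  vanish N (convective Q ((H ^+ k) a b) - (H ^+ k.+1) a b *+ k).
Proof.
elim: k a b => [|k IH] a b.
  rewrite mulr0n subr0 expr0 mxE; case: (a == b) => /=.
    have -> : convective Q 1 = 0; last exact: vanish0.
    rewrite /convective derivC big1 ?subr0 // => c _.
    have := pderivM c 1 1; rewrite !mulr1 mul1r => /eqP.
    by rewrite -subr_eq0 opprD addNKr oppr_eq0 => /eqP ->; rewrite mulr0.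
  have -> : convective Q 0 = 0; last exact: vanish0.
  rewrite /convective deriv0 big1 ?subr0 // => c _.
  by rewrite [X in _ * X]raddf0 mulr0.
have -> : convective Q ((H ^+ k.+1) a b) - (H ^+ k.+2) a b *+ k.+1
  = \sum_c ((convective Q ((H ^+ k) a c) - (H ^+ k.+1) a c *+ k) * H c b
      + (H ^+ k) a c * (convective Q (H c b) - (H *m H) c b)).
  have -> : (H ^+ k.+2) a b *+ k.+1
      = \sum_c (H ^+ k) a c * (H *m H) c b + \sum_c (H ^+ k.+1) a c * H c b *+ k.
    rewrite mulrS; congr (_ + _); first by rewrite -addn2 exprD mxE.
    by rewrite sumrMnl exprSr mxE.
  rewrite exprSr [in LHS]mxE convective_sum -big_split -sumrB /=.
  apply: eq_bigr => c _; rewrite convectiveM; ring.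
apply: vanish_sum => c; apply: vanishD.
  exact/vanishMr/IH.
(* The Riccati defect is half a second z-derivative of the Burgers defect, so it vanishes to the
   same order. *)
apply/vanishMl/vanish_half; rewrite convective_phessian.
exact/vanish_pderiv/vanish_pderiv.
Qed.

Lemma convective_trace k :
  vanish N (convective Q (\tr (H ^+ k)) - \tr (H ^+ k.+1) *+ k).
Proof.
rewrite /mxtrace convective_sum -sumrMnl -sumrB.
by apply: vanish_sum => a; apply: convective_phessianX.
Qed.

Lemma map_coef0_phessian k :
  map_mx (coefp 0) (H ^+ k) = hessian Q`_0 ^+ k.
Proof.
rewrite rmorphXn; congr (_ ^+ _).
by apply/matrixP => a b; rewrite !mxE /= !coef_map.
Qed.

Hypothesis Q0_HN : hessian_nilpotent Q`_0.

(** Induction on the order, for all powers at once: [d/dt tr H^l] is a combination of [tr H^(l+1)]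
    and z-derivatives of [tr H^l] modulo [t^N], and integrating in t gains one order. *)
Lemma vanish_trace k : vanish N.+1 (\tr (H ^+ k.+1)).
Proof.
suff trj j l : (j <= N)%N -> vanish j.+1 (\tr (H ^+ l.+1)) by apply: trj.
elim: j l => [|j IH] l jN.
  move=> i; rewrite ltnS leqn0 => /eqP ->.
  have [e He] := Q0_HN.
  have <- : \tr (hessian Q`_0 ^+ l.+1) = (\tr (H ^+ l.+1))`_0.
    by rewrite -map_coef0_phessian trace_map_mx.
  by apply: (@mxtrace_nilpotent _ _ e); rewrite exprAC He expr0n.
move=> [|i] ij; first exact: (IH l (ltnW jN)).
have : vanish j.+1 (\tr (H ^+ l.+1))^`().
  have -> : (\tr (H ^+ l.+1))^`()
    = (convective Q (\tr (H ^+ l.+1)) - \tr (H ^+ l.+2) *+ l.+1)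
      + \tr (H ^+ l.+2) *+ l.+1
      + \sum_c pderiv c Q * pderiv c (\tr (H ^+ l.+1)).
    by rewrite /convective !subrK.
  apply: vanishD; first apply: vanishD.
  - exact/(vanishW jN)/convective_trace.
  - exact/vanishMn/IH/ltnW.
  - by apply: vanish_sum => c; apply/vanishMl/vanish_pderiv/IH/ltnW.
move/(_ i ij); rewrite coef_deriv -scaler_nat => /eqP.
by rewrite scaler_eq0 pnatr_eq0 => /eqP.
Qed.

Lemma vanish_plap : vanish N.+1 (plap Q).
Proof.
rewrite plapE; have := vanish_trace 0; rewrite expr1.
by congr (vanish _ _); apply: eq_bigr => c _; rewrite mxE.
Qed.

(** In [Delta Q^(k+2)], the equation trades [|grad Q|^2] for [2 dQ/dt], and the term with [Delta Q]
    is negligible. *)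
Lemma heat_power k :
  vanish N (plap (Q ^+ k.+2) - (Q ^+ k.+1)^`() *+ (2 * k.+2)).
Proof.
have -> : plap (Q ^+ k.+2) - (Q ^+ k.+1)^`() *+ (2 * k.+2)
  = Q ^+ k.+1 * plap Q *+ k.+2 - Q ^+ k * burgers Q *+ (k.+1 * k.+2).
  rewrite !plapE /burgers mulrBr mulr_sumr mulr_sumr mulrnBl -!sumrMnl.
  rewrite opprB addrA -big_split deriv_exp /=; congr (_ - _).
    apply: eq_bigr => c _; rewrite pderivX pderivMn pderivM pderivX.
    by ring.
  by rewrite -mulr_natr; ring.
apply: vanishD; last exact/vanishN/vanishMn/vanishMl.
exact/vanishMn/vanishMl/(vanishW (leqnSn N))/vanish_plap.
Qed.

Lemma vanish_iter_plap k :
  vanish (N.+1 - k) (iter k.+1 plap (Q ^+ k.+1)).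
Proof.
elim: k => [|k IH]; first by rewrite subn0 expr1; apply: vanish_plap.
rewrite iterSr -(subrK ((Q ^+ k.+1)^`() *+ (2 * k.+2)) (plap _)).
have plapD m p q : iter m plap (p + q) = iter m plap p + iter m plap q.
  by elim: m => //= m ->; apply: raddfD.
have plapMn m p l : iter m plap (p *+ l) = iter m plap p *+ l.
  by elim: m => //= m ->; apply: raddfMn.
have plap_deriv m p : iter m plap p^`() = (iter m plap p)^`().
  by elim: m => //= m ->; apply: map_poly_deriv.
have plap_vanish m M p : vanish M p -> vanish M (iter m plap p).
  by move=> pM; elim: m => //= m; apply: vanish_map.
rewrite plapD plapMn plap_deriv subSS; apply: vanishD.
  exact/plap_vanish/(vanishW (leq_subr _ _))/heat_power.
(* Each time derivative costs one order of vanishing; once [N < k] the claim is empty. *)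
have [kN|Nk] := leqP k N; last by move=> i; rewrite (eqP (ltnW Nk)).
by apply/vanishMn/vanish_deriv; rewrite -subSn.
Qed.

End HessianFlow.

Theorem iter_laplacian_HN (P : A) k : hessian_nilpotent P ->
  iter k.+1 (@laplacian n C) (P ^+ k.+1) = 0.
Proof.
move=> P_HN; have [Q [Q0 QN]] := burgers_solution k P.
have Q_HN : hessian_nilpotent Q`_0 by rewrite Q0.
have /(_ 0%N) := vanish_iter_plap QN Q_HN (k := k).
(* Solving modulo [t^k] leaves order exactly one, enough to read off the constant coefficient. *)
rewrite subSnn coef_iter_plap => <- //; congr (iter _ _ _).
by rewrite -[RHS]/(coefp 0 _) rmorphXn /= Q0.
Qed.

End Burgers.

(** * The generators of the ideal *)

Lemma gradient_diffop_HN (n d : nat) (C : numFieldType) (P : {mpoly C[n]})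
    (i : 'I_n) (m : nat) :
  (3 <= d)%N -> P \is d.-homog -> hessian_nilpotent P ->
  poly_diffop (mderiv i P) (iter m (@laplacian n C) (P ^+ m.+1)) = 0.
Proof.
case: d => // d d_ge2 P_homog P_HN.
have [c c_gt0 contract] := iter_laplacian_harmonicM n C d m.
have P0 : laplacian P = 0 by have := iter_laplacian_HN 0 P_HN; rewrite expr1.
have Pi0 : laplacian (mderiv i P) = 0.
  by have := mderiv_iter_laplacian i 1 P; rewrite /= P0 linear0.
have top0 : iter (m + d) (@laplacian n C) (mderiv i P * P ^+ m.+1) = 0.
  have : iter (m + d) (@laplacian n C) (mderiv i (P ^+ m.+2)) = 0.
    rewrite mderiv_iter_laplacian (iter_laplacian0 (iter_laplacian_HN _ P_HN)).
      by rewrite linear0.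
    (* Here [d] is one less than the degree of [P], hence at least 2. *)
    by rewrite -addn2 leq_add2l.
  rewrite mderivXn linearMn -scaler_nat => /eqP.
  by rewrite scaler_eq0 pnatr_eq0 => /eqP.
move: top0; rewrite contract ?dhomog_mderiv ?iter_laplacian_HN //.
rewrite -scaler_nat => /eqP; rewrite scaler_eq0 pnatr_eq0.
by case: eqP c_gt0 => [->|_ _ /eqP].
Qed.

(* R[i], for R a model of the real numbers, is the field of complex numbers. *)
Theorem theorem6p3 (R : realType) (n d : nat) (P : {mpoly R[i][n]})
  (d_ge3 : (3 <= d)%N) (P_homog : P \is d.-homog)
  (P_HN : hessian_nilpotent P)
  (f : {mpoly R[i][n]}) (f_in_I : ideal_I P f) (m : nat) :
  poly_diffop f (iter m (@laplacian n _) (P ^+ m.+1)) = 0.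
Proof.
case: f_in_I => c ->; rewrite poly_diffop_suml big1 // => k _.
rewrite poly_diffopM [X in poly_diffop _ X](_ : _ = 0) ?linear0 //.
have := mem_nth 0 (ltn_ord k); rewrite inE => /predU1P[->|/mapP[i _ ->]].
  (* The generator [sigma2] acts as one more Laplacian. *)
  by rewrite poly_diffop_sigma2 -iterS iter_laplacian_HN.
exact: gradient_diffop_HN P_homog P_HN.
Qed.
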